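(* Let $\mathcal{N}$ be a structure and let $\mathcal{N}_1,\mathcal{N}_2$ be quantifier-free reducts of $\mathcal{N}$ such that $\operatorname{Aut}(\mathcal{N})=\operatorname{Aut}(\mathcal{N}_1)\cap\operatorname{Aut}(\mathcal{N}_2)$ (i.e. $\mathcal{N}=\mathcal{N}_1\vee\mathcal{N}_2$ in the lattice of quantifier-free reducts of $\mathcal{N}$ up to interdefinability). Then $\mathrm{K}(\mathcal{N}_1)\cap\mathrm{K}(\mathcal{N}_2)=\mathrm{K}(\mathcal{N})$.
   Context: A quantifier-free reduct of $\mathcal{N}$ is a structure on the same domain all of whose relations and functions are quantifier-free $\emptyset$-definable in $\mathcal{N}$. For a class $\mathcal{K}$ of structures in a relational language $\mathcal{L}_0$, an $\mathcal{L}$-structure $\mathcal{M}$ admits a $\mathcal{K}$-configuration if there are $n\in\mathbb{N}$, a function $I$ from relation symbols of $\mathcal{L}_0$ to $\mathcal{L}$-formulas and functions $f_A:A\to\mathcal{M}^n$ ($A\in\mathcal{K}$) with $A\models R(a)\iff\mathcal{M}\models I(R)(f_A(a))$ for all relation symbols $R$, $A\in\mathcal{K}$, $a\in A^{\mathrm{arity}(R)}$. $\mathrm{K}(\mathcal{N})$ denotes the class of complete theories having a model that admits an $\operatorname{age}(\mathcal{N})$-configuration (equivalently a $\{\mathcal{N}\}$-configuration).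
   Formalization: Besides Aut(N)=Aut(N1)∩Aut(N2), N is assumed to be the join N1∨N2 for quantifier-free definability (strictly stronger; the Aut equality alone does not suffice), and K(·) is restricted to complete theories with infinite models, as the claim fails for theories of finite structures. *)

(* Defs.v *)
From mathcomp Require Import all_boot.
From mathcomp Require Import boolp classical_sets cardinality.

Set Implicit Arguments.
Unset Strict Implicit.
Unset Printing Implicit Defensive.

Local Open Scope classical_set_scope.

Record language := Language {
  funsym : Type;
  funar : funsym -> nat;
  relsym : Type;
  relar : relsym -> nat
}.

Definition relational (L : language) : Prop := funsym L -> False.

Inductive term (L : language) (V : Type) : Type :=
| tvar of V
| tapp (f : funsym L) of ('I_(funar f) -> term L V).

(* [formula L V] has its free variables in [V]; a quantifier binds [None]. *)
Inductive formula (L : language) (V : Type) : Type :=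
| fbot
| feq of term L V & term L V
| frel (R : relsym L) of ('I_(relar R) -> term L V)
| fimp of formula L V & formula L V
| fall of formula L (option V).

Arguments fbot {L V}.

Definition fnot (L : language) (V : Type) (phi : formula L V) : formula L V :=
  fimp phi fbot.

Definition sentence (L : language) : Type := formula L void.

Fixpoint quantifier_free (L : language) (V : Type) (phi : formula L V) : bool :=
  match phi with
  | fbot | feq _ _ | frel _ _ => true
  | fimp phi1 phi2 => quantifier_free phi1 && quantifier_free phi2
  | fall _ => false
  end.

(* Structures are not bundled with their domain, so that a structure and its
   reducts literally share it. *)
Record structure (L : language) (D : Type) := Structure {
  dom_inhabited : inhabited D;
  fint : forall f : funsym L, ('I_(funar f) -> D) -> D;
  rint : forall R : relsym L, ('I_(relar R) -> D) -> Prop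
}.

Fixpoint eval (L : language) (D : Type) (M : structure L D) (V : Type)
    (v : V -> D) (t : term L V) : D :=
  match t with
  | tvar x => v x
  | tapp f ts => fint M (fun i => eval M v (ts i))
  end.

Fixpoint sat (L : language) (D : Type) (M : structure L D) (V : Type)
    (v : V -> D) (phi : formula L V) : Prop :=
  match phi with
  | fbot => False
  | feq t1 t2 => eval M v t1 = eval M v t2
  | frel R ts => rint M (fun i => eval M v (ts i))
  | fimp phi1 phi2 => sat M v phi1 -> sat M v phi2
  | fall phi1 => forall d : D, sat M (oapp v d) phi1
  end.

Definition holds (L : language) (D : Type) (M : structure L D)
    (phi : sentence L) : Prop :=
  sat M (fun x : void => match x with end) phi.

Definition theory (L : language) : Type := set (sentence L).

Definition models (L : language) (D : Type) (M : structure L D)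
    (T : theory L) : Prop :=
  forall phi, T phi -> holds M phi.

Definition entails (L : language) (T : theory L) (phi : sentence L) : Prop :=
  forall (D : Type) (M : structure L D), models M T -> holds M phi.

(* As usual for dividing lines, theories of finite structures are excluded.
   Configurations do not have to respect equality whereas quantifier-free
   formulas may use it, so on theories of finite structures K is not even
   invariant under quantifier-free interdefinability. *)
Definition complete_theory (L : language) (T : theory L) : Prop :=
  [/\ exists (D : Type) (M : structure L D), models M T,
      forall (D : Type) (M : structure L D),
        models M T -> infinite_set [set: D]
    & forall phi : sentence L, entails T phi \/ entails T (fnot phi)].

Definition automorphism (L : language) (D : Type) (N : structure L D)
    (s : D -> D) : Prop :=
  [/\ bijective s,
      forall (R : relsym L) (a : 'I_(relar R) -> D),
        rint N a <-> rint N (fun i => s (a i))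
    & forall (f : funsym L) (a : 'I_(funar f) -> D),
        s (fint N a) = fint N (fun i => s (a i))].

Definition Aut (L : language) (D : Type) (N : structure L D) : set (D -> D) :=
  [set s | automorphism N s].

Definition qf_definable (L : language) (D : Type) (N : structure L D)
    (V : Type) (X : set (V -> D)) : Prop :=
  exists phi : formula L V,
    quantifier_free phi /\ forall v : V -> D, X v <-> sat N v phi.

(* [N'] is a quantifier-free reduct of [N]; a function is definable when its
   graph is, the variable [None] standing for the value. *)
Definition qf_reduct (L L' : language) (D : Type)
    (N : structure L D) (N' : structure L' D) : Prop :=
  (forall R : relsym L', qf_definable N [set a | rint N' (R := R) a]) /\
  (forall f : funsym L',
    qf_definable N [set b : option 'I_(funar f) -> D |
      fint N' (f := f) (fun i => b (Some i)) = b None]).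

(* [N] is the join of [N1] and [N2] in the lattice of quantifier-free reducts
   of [N] up to interdefinability: a least upper bound for the preorder
   "is a quantifier-free reduct of". This implies
   Aut N = Aut N1 `&` Aut N2; the converse fails. *)
Definition qf_join (L L1 L2 : language) (D : Type) (N : structure L D)
    (N1 : structure L1 D) (N2 : structure L2 D) : Prop :=
  [/\ qf_reduct N N1, qf_reduct N N2
    & forall (L' : language) (N' : structure L' D),
        qf_reduct N N' -> qf_reduct N' N1 -> qf_reduct N' N2 ->
        qf_reduct N' N].

Definition structure_class (L : language) : Type :=
  forall A : Type, structure L A -> Prop.

Definition embedding (L : language) (A D : Type) (SA : structure L A)
    (N : structure L D) (e : A -> D) : Prop :=
  [/\ injective e,
      forall (R : relsym L) (a : 'I_(relar R) -> A),
        rint SA a <-> rint N (fun i => e (a i))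
    & forall (f : funsym L) (a : 'I_(funar f) -> A),
        e (fint SA a) = fint N (fun i => e (a i))].

(* For relational languages, where finitely generated means finite. *)
Definition age (L : language) (D : Type) (N : structure L D) :
    structure_class L :=
  fun A SA => finite_set [set: A] /\ exists e : A -> D, embedding SA N e.

(* The variable [(i, j)] of [I R] is the [j]-th coordinate of the [i]-th
   argument of [R]. *)
Definition admits_configuration (L0 L : language) (K : structure_class L0)
    (D : Type) (M : structure L D) : Prop :=
  exists (n : nat) (I : forall R : relsym L0, formula L ('I_(relar R) * 'I_n))
    (f : forall (A : Type) (SA : structure L0 A), K A SA -> A -> 'I_n -> D),
  forall (R : relsym L0) (A : Type) (SA : structure L0 A) (KA : K A SA)
    (a : 'I_(relar R) -> A),
    rint SA a <-> sat M (fun p => f A SA KA (a p.1) p.2) (I R).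

(* The L-theories in K(N). *)
Definition KK (L0 : language) (D : Type) (N : structure L0 D) (L : language) :
    set (theory L) :=
  [set T | complete_theory T /\
    exists (E : Type) (M : structure L E),
      models M T /\ admits_configuration (age N) M].
Arguments KK {L0 D} N L.

(* Main.v *)
Require Import Defs.
From mathcomp Require Import all_boot.
From mathcomp Require Import boolp classical_sets functions cardinality filter.

(* An age(N)-configuration in an infinite model yields one of any structure
   quantifier-free definable in N: configurations need not respect equality, but
   an extra coordinate mapping each finite structure injectively into the model
   does. As N is the join of N1 and N2, it is quantifier-free definable in the
   structure N1 + N2 carrying the relations of both. Given configurations of N1
   and N2 in two models of T, these models have a common elementary extension
   because T is complete, and there the concatenation of the two configurations
   is one of N1 + N2. *)

Set Implicit Arguments.
Unset Strict Implicit.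
Unset Printing Implicit Defensive.

Local Open Scope classical_set_scope.

(** * Renaming variables and closing formulas *)

Fixpoint trename (L : language) (V W : Type) (h : V -> W) (t : term L V) :
    term L W :=
  match t with
  | tvar x => tvar L (h x)
  | tapp f ts => tapp (fun i => trename h (ts i))
  end.

Fixpoint rename (L : language) (V W : Type) (h : V -> W) (phi : formula L V) :
    formula L W :=
  match phi with
  | fbot => fbot
  | feq t1 t2 => feq (trename h t1) (trename h t2)
  | Defs.frel R ts => Defs.frel (fun i => trename h (ts i))
  | fimp phi1 phi2 => fimp (rename h phi1) (rename h phi2)
  | fall phi1 => fall (rename (omap h) phi1)
  end.

Lemma eval_rename (L : language) (D : Type) (M : structure L D) (V W : Type)
    (h : V -> W) (v : W -> D) (t : term L V) :
  eval M v (trename h t) = eval M (v \o h) t.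
Proof.
by elim: t => //= f ts IH; congr fint; apply/funext => i; exact: IH.
Qed.

Lemma sat_rename (L : language) (D : Type) (M : structure L D) (V W : Type)
    (h : V -> W) (v : W -> D) (phi : formula L V) :
  sat M v (rename h phi) = sat M (v \o h) phi.
Proof.
elim: phi W h v => {V} //= [V t1 t2|V R ts|V phi1 IH1 phi2 IH2|V phi IH] W h v.
- by rewrite !eval_rename.
- by congr rint; apply/funext => i; rewrite eval_rename.
- by rewrite IH1 IH2.
- apply: eq_forall => d; rewrite IH; congr sat.
  by apply/funext => -[].
Qed.

Lemma eval_finite_support (L : language) (V : Type) (t : term L V) :
  exists S : set V, finite_set S /\
    forall (D : Type) (M : structure L D) (v w : V -> D),
      (forall x, S x -> v x = w x) -> eval M v t = eval M w t.
Proof.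
elim: t => [x|f ts IH].
  by exists [set x]; split => // D M v w; exact.
have [S SP] := choice IH.
exists (\bigcup_i S i); split => [|D M v w vw /=].
  by apply: bigcup_finite => // i _; have [] := SP i.
congr fint; apply/funext => i; have [_] := SP i; apply => x Sx.
by apply: vw; exists i.
Qed.

(** All arities are finite, so a formula has finitely many free variables even when [V] is infinite.
    The set [S] is chosen before the structure, so that one closure serves all structures. *)
Lemma sat_finite_support (L : language) (V : Type) (phi : formula L V) :
  exists S : set V, finite_set S /\
    forall (D : Type) (M : structure L D) (v w : V -> D),
      (forall x, S x -> v x = w x) -> sat M v phi = sat M w phi.
Proof.
elim: phi => {V} [V|V t1 t2|V R ts|V phi1 [S1 [fS1 S1P]] phi2 [S2 [fS2 S2P]]
  |V phi [S [fS SP]]].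
- by exists set0; split.
- have [S1 [fS1 S1P]] := eval_finite_support t1.
  have [S2 [fS2 S2P]] := eval_finite_support t2.
  exists (S1 `|` S2); split => [|D M v w vw /=]; first by rewrite finite_setU.
  rewrite (S1P _ M v w) ?(S2P _ M v w) // => x Sx; apply: vw; first by right.
  by left.
- have [S SP] := choice (fun i => eval_finite_support (ts i)).
  exists (\bigcup_i S i); split => [|D M v w vw /=].
    by apply: bigcup_finite => // i _; have [] := SP i.
  congr rint; apply/funext => i; have [_] := SP i; apply => x Sx.
  by apply: vw; exists i.
- exists (S1 `|` S2); split => [|D M v w vw /=]; first by rewrite finite_setU.
  rewrite (S1P _ M v w) ?(S2P _ M v w) // => x Sx; apply: vw; first by right.
  by left.
- exists (Some @^-1` S); split => [|D M v w vw /=].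
    by apply: finite_preimage => // x y _ _ [].
  by apply: eq_forall => d; apply: SP => -[x /vw|].
Qed.

Lemma universal_closure (L : language) (k : nat) (phi : formula L 'I_k) :
  exists sigma : sentence L, forall (D : Type) (M : structure L D),
    holds M sigma <-> forall v : 'I_k -> D, sat M v phi.
Proof.
elim: k phi => [|k IH] phi.
  exists (rename (fun i : 'I_0 => match notF (valP i) with end) phi) => D M.
  rewrite /holds sat_rename; split => [H v|]; last exact.
  by congr (sat M _ phi): H; apply/funext => -[].
(* [unlift ord_max] sends the last variable to the bound one, [None], and the others to ['I_k]. *)
have [sigma sP] := IH (fall (rename (unlift ord_max) phi)).
exists sigma => D M; rewrite sP /=; split => [H v|H v d].
  have := H (v \o lift ord_max) (v ord_max); rewrite sat_rename.
  congr sat; apply/funext => i /=.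
  by case: unliftP => [j|] ->.
by rewrite sat_rename; exact: H.
Qed.

(** The type [V] may be infinite, for instance the domain of a structure. The support is renamed
    injectively into an ordinal, where the closure is the negated universal closure of the
    negation. *)
Lemma existential_closure (L : language) (V : Type) (phi : formula L V) :
  exists sigma : sentence L, forall (D : Type) (M : structure L D),
    holds M sigma <-> exists v : V -> D, sat M v phi.
Proof.
have [S [/finite_set_leP[n /pcard_leP/unsquash f] SP]] := sat_finite_support phi.
(* [inord] needs a nonempty ordinal, hence [n.+1]; only the values of [r] on [S] matter. *)
pose r (x : V) : 'I_n.+1 := inord (f x).
have rI x y : S x -> S y -> r x = r y -> x = y.
  have fS z : S z -> (f z < n.+1)%N by move=> Sz; exact: ltnW ('funS_f Sz).
  move=> Sx Sy /(congr1 val); rewrite /= !inordK ?fS// => fxy.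
  by apply: (@inj _ _ _ f); rewrite ?inE.
have [sigma sP] := universal_closure (fnot (rename r phi)).
exists (fnot sigma) => D M.
have [d0] := dom_inhabited M.
rewrite /holds/= -/(holds M sigma) sP /=; split => [|[v vphi] H].
  move/existsNP => [v /contrapT]; rewrite sat_rename => vphi.
  by exists (v \o r).
(* [w] undoes [r] on [S] and takes the default value [d0] at indices that are not hit. *)
pose w i := if pselect (exists2 x, S x & r x = i) is left e
            then v (projT1 (cid2 e)) else d0.
apply: (H w); rewrite sat_rename -(SP _ M v)// => x Sx /=; rewrite /w.
case: pselect => [e|[]]; last by exists x.
by case: (cid2 e) => y /= Sy /(rI _ _ Sy Sx) ->.
Qed.

(** * Ultrapowers and Łoś's theorem *)

Definition ueq (J E : Type) (U : set_system J) (g h : J -> E) : Prop :=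
  U [set j | g j = h j].

(** The quotient of [J -> E] by [ueq U]: an element is a whole class, stored as a set of maps, so
    that equality of elements is Rocq equality. *)
Definition upower (J : Type) (U : set_system J) (E : Type) : Type :=
  {c : set (J -> E) | exists g, c = ueq U g}.

Definition ucls (J : Type) (U : set_system J) (E : Type) (g : J -> E) :
    upower U E :=
  exist _ (ueq U g) (ex_intro _ g erefl).

Definition urepr (J : Type) (U : set_system J) (E : Type) (c : upower U E) :
    J -> E :=
  projT1 (cid (proj2_sig c)).

Lemma ureprK (J : Type) (U : set_system J) (E : Type) :
  cancel (@urepr J U E) (@ucls J U E).
Proof. by case=> c cP; apply: eq_exist; rewrite /urepr; case: cid => g /= ->. Qed.

Lemma ucls_eq (J : Type) (U : set_system J) (E : Type) (g h : J -> E) :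
  Filter U -> ucls U g = ucls U h <-> ueq U g h.
Proof.
move=> FU; split => [/(congr1 (@proj1_sig _ _)) /= gh|gh].
  by rewrite gh; exact: filterE.
apply: eq_exist; apply/funext => k; apply/propext; rewrite /ueq; split.
  by apply: filterS2 gh => j /= ->.
by apply: filterS2 gh => j /= ->.
Qed.

Lemma ueq_urepr (J : Type) (U : set_system J) (E : Type) (g : J -> E) :
  Filter U -> ueq U (urepr (ucls U g)) g.
Proof. by move=> FU; apply/ucls_eq; exact: ureprK. Qed.

Definition ultrapower (J : Type) (U : set_system J) (L : language) (E : Type)
    (M : structure L E) : structure L (upower U E) :=
  Structure
    (let: inhabits e := dom_inhabited M in inhabits (ucls U (fun=> e)))
    (fun f a => ucls U (fun j => fint M (fun i => urepr (a i) j)))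
    (fun R a => U [set j | rint M (fun i => urepr (a i) j)]).

Lemma eval_ultrapower (J : Type) (U : set_system J) (L : language) (E : Type)
    (M : structure L E) (V : Type) (g : V -> J -> E) (t : term L V) :
  Filter U ->
  eval (ultrapower U M) (fun x => ucls U (g x)) t =
  ucls U (fun j => eval M (g^~ j) t).
Proof.
move=> FU; elim: t => //= f ts IH; apply/ucls_eq; rewrite /ueq /=.
(* A symbol has finitely many arguments, so a single set in [U] makes all representatives agree with
   the given maps. *)
have : U [set j | forall i, urepr (ucls U (fun j => eval M (g^~ j) (ts i))) j =
                            eval M (g^~ j) (ts i)].
  by apply: filter_forall => i; exact: ueq_urepr.
apply: filterS => j /= H; congr fint; apply/funext => i.
by rewrite IH H.
Qed.

(** Łoś's theorem, by induction on the formula. Maximality of [U] is used for implications and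
    quantifiers. *)
Lemma los (J : Type) (U : set_system J) (L : language) (E : Type)
    (M : structure L E) (V : Type) (g : V -> J -> E) (phi : formula L V) :
  UltraFilter U ->
  sat (ultrapower U M) (fun x => ucls U (g x)) phi <->
  U [set j | sat M (g^~ j) phi].
Proof.
move=> UU; elim: phi g => {V} [V|V t1 t2|V R ts|V phi1 IH1 phi2 IH2|V phi IH] g
  /=.
- by split => // /filter_ex[].
- by rewrite !eval_ultrapower ucls_eq.
- have : U [set j | forall i,
      urepr (ucls U (fun j => eval M (g^~ j) (ts i))) j = eval M (g^~ j) (ts i)].
    by apply: filter_forall => i; exact: ueq_urepr.
  have HE j : (forall i, urepr (ucls U (fun j => eval M (g^~ j) (ts i))) j =
                         eval M (g^~ j) (ts i)) ->
      (fun i => urepr (eval (ultrapower U M) (fun x => ucls U (g x)) (ts i)) j) =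
      (fun i => eval M (g^~ j) (ts i)).
    by move=> H; apply/funext => i; rewrite eval_ultrapower.
  by move=> H; split; apply: filterS2 H => j /= /HE ->.
- rewrite IH1 IH2; split => [H|H H1]; last first.
    by apply: filterS2 H H1 => j; exact.
  (* If the complement is in [U], the implication holds vacuously on it. *)
  case: (in_ultra_setVsetC [set j | sat M (g^~ j) phi1] UU) => [/H|].
    by apply: filterS => j /= ? _.
  by apply: filterS => j /= n /n.
- have gE h : (fun x => ucls U (oapp g h x)) =
              oapp (fun x => ucls U (g x)) (ucls U h).
    by apply/funext => -[].
  have gE' (h : J -> E) j : (oapp g h)^~ j = oapp (g^~ j) (h j).
    by apply/funext => -[].
  split => [H|H d]; last first.
    rewrite -(ureprK d) -gE IH; apply: filterS H => j /= /(_ (urepr d j)).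
    by rewrite gE'.
  case: (in_ultra_setVsetC [set j | forall d, sat M (oapp (g^~ j) d) phi] UU)
    => // H'.
  have [e0] := dom_inhabited M.
  (* [h] picks a counterexample at each index that has one, and [e0] elsewhere; its class then
     refutes the universal statement in the ultrapower. *)
  have /choice[h hP] : forall j, exists d,
      (~ forall d', sat M (oapp (g^~ j) d') phi) -> ~ sat M (oapp (g^~ j) d) phi.
    move=> j; have [/existsNP[d nd]|] :=
      pselect (~ forall d', sat M (oapp (g^~ j) d') phi); first by exists d.
    by exists e0.
  have := H (ucls U h); rewrite -gE IH => Hh.
  exfalso; apply: (filter_not_empty U); apply: filterS2 H' Hh => j /= /hP.
  by rewrite gE'.
Qed.

(** * Elementary extensions *)

Definition elementary (L : language) (E F : Type) (M : structure L E)
    (M' : structure L F) (e : E -> F) : Prop :=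
  forall (V : Type) (v : V -> E) (phi : formula L V),
    sat M v phi <-> sat M' (e \o v) phi.

(* The ultrapower of [M2] is indexed by the maps [j : E1 -> E2], and the
   ultrafilter contains the sets of those [j] satisfying in [M2] a given formula
   with parameters true in [M1]; the class of [j |-> j x] is the image of [x]. *)
Lemma common_elementary_extension (L : language) (E1 E2 : Type)
    (M1 : structure L E1) (M2 : structure L E2) :
  (forall sigma : sentence L, holds M1 sigma -> holds M2 sigma) ->
  exists (F : Type) (M : structure L F) (e1 : E1 -> F) (e2 : E2 -> F),
    elementary M1 M e1 /\ elementary M2 M e2.
Proof.
move=> M12.
pose true1 := [set theta : formula L E1 | sat M1 id theta].
pose base (theta : formula L E1) := [set j : E1 -> E2 | sat M2 j theta].
have FF : ProperFilter (filter_from true1 base).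
  apply: filter_from_proper => [|theta theta1].
    apply: filter_from_filter; first by exists (fnot fbot).
    (* This formula is the conjunction of [a] and [b]. *)
    move=> a b ta tb; exists (fnot (fimp a (fnot b))) => [/=|j /=]; first exact.
    by move=> H; split; apply: contrapT => n; apply: H => // ? ?.
  (* The identity witnesses the closure of [theta] in [M1]; the sentence transfers to [M2], where a
     witness is a map in [base theta]. *)
  have [sigma sP] := existential_closure theta.
  by apply/sP/M12/sP; exists id.
have [U [UU FU]] := ultraFilterLemma FF.
exists _, (ultrapower U M2), (fun x => ucls U (fun j : E1 -> E2 => j x)),
  (fun x => ucls U (fun=> x)).
split => V v phi.
  have H psi : sat M1 v psi -> U [set j | sat M2 ((j : E1 -> E2) \o v) psi].
    move=> psi1; apply: FU; exists (rename v psi).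
      by rewrite /true1 /= sat_rename.
    by move=> j; rewrite /base /= sat_rename.
  apply: iff_trans (iff_sym (los M2 (fun x (j : E1 -> E2) => j (v x)) phi UU)).
  (* The converse is [H] applied to the negation of [phi]. *)
  split => [/H//|U2]; apply: contrapT => /(H (fnot phi)) /= U2'.
  by apply: (filter_not_empty U); apply: filterS2 U2 U2' => j /= p /(_ p).
(* For constant families the set of indices is either everything or empty. *)
apply: iff_trans (iff_sym (los M2 (fun x (j : E1 -> E2) => v x) phi UU)).
by split => [v2|/filter_ex[]//]; exact: filterE.
Qed.

Lemma elementary_holds (L : language) (E F : Type) (M : structure L E)
    (M' : structure L F) (e : E -> F) (sigma : sentence L) :
  elementary M M' e -> holds M sigma <-> holds M' sigma.
Proof.
move=> /(_ _ _ sigma) H; apply: iff_trans; first exact: H.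
by rewrite /holds; have -> : e \o (fun x : void => match x with end) =
  (fun x : void => match x with end) by apply/funext => -[].
Qed.

Lemma elementary_configuration (L0 L : language) (K : structure_class L0)
    (E F : Type) (M : structure L E) (M' : structure L F) (e : E -> F) :
  elementary M M' e -> admits_configuration K M -> admits_configuration K M'.
Proof.
move=> eM [n [I [f fP]]]; exists n, I, (fun A SA KA a => e \o f A SA KA a).
by move=> R A SA KA a; rewrite fP; exact: eM.
Qed.

(** * Configurations of ages and quantifier-free reducts *)

Lemma finite_infinite_inj (A E : Type) :
  finite_set [set: A] -> infinite_set [set: E] ->
  exists g : A -> E, injective g.
Proof.
move=> /finite_set_leP[n An] /infiniteP NE.
have nN : (`I_n #<= [set: nat])%card by exact: subset_card_le.
have /card_leP[g] := card_le_trans An (card_le_trans nN NE).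
exists (fun a => val (g (to_setT a))) => x y /val_inj /inj => H.
by have /(congr1 val) := H (mem_set I) (mem_set I).
Qed.

Definition pullback (L : language) (relL : relational L) (A D : Type)
    (N : structure L D) (e : A -> D) (inhA : inhabited A) : structure L A :=
  Structure inhA (fun f => match relL f with end)
    (fun R a => rint N (e \o a)).

Lemma pullback_age (L : language) (relL : relational L) (A D : Type)
    (N : structure L D) (e : A -> D) (inhA : inhabited A) :
  finite_set [set: A] -> injective e -> age N (pullback relL N e inhA).
Proof. by move=> fA ie; split => //; exists e; split => // f; case: (relL f). Qed.

(** Members of the age are exactly the pullbacks of [N] along injections of finite inhabited types.
    In this form the same [A] and [e] can be kept when [N] is replaced by another structure on
    [D]. *)
Lemma age_configurationP (L0 L : language) (relL0 : relational L0)
    (D E : Type) (N : structure L0 D) (M : structure L E) :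
  admits_configuration (age N) M <->
  exists (n : nat) (I : forall R : relsym L0, formula L ('I_(relar R) * 'I_n)),
    forall (A : Type) (e : A -> D),
      inhabited A -> finite_set [set: A] -> injective e ->
      exists f : A -> 'I_n -> E,
        forall (R : relsym L0) (a : 'I_(relar R) -> A),
          rint N (e \o a) <-> sat M (fun p => f (a p.1) p.2) (I R).
Proof.
split=> [[n [I [f fP]]]|[n [I IP]]]; exists n, I.
  move=> A e inhA fA ie; exists (f _ _ (pullback_age relL0 N inhA fA ie)).
  by move=> R a; exact: (fP _ _ (pullback relL0 N e inhA)).
(* A configuration is a function of [SA] and of the proof [KA], so the maps are extracted by
   choice. *)
have F A (SA : structure L0 A) (KA : age N SA) :
    {f : A -> 'I_n -> E | forall (R : relsym L0) (a : 'I_(relar R) -> A),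
      rint SA a <-> sat M (fun p => f (a p.1) p.2) (I R)}.
  apply: cid; case: KA => fA [e [ie eR _]].
  have [f fP] := IP A e (dom_inhabited SA) fA ie.
  by exists f => R a; rewrite eR; exact: fP.
by exists (fun A SA KA => sval (F A SA KA)) => R A SA KA; case: F.
Qed.

Lemma relational_tvar (L : language) (V : Type) (t : term L V) :
  relational L -> exists x, t = tvar L x.
Proof. by case: t => [x|f ts relL]; [exists x | case: (relL f)]. Qed.

(* Configurations need not respect equality, so that the equality of [N] is
   interpreted by that of an extra coordinate (the last one), on which [A] is
   mapped injectively. *)
Lemma qf_translation (L0 L : language) (relL0 : relational L0) (n : nat)
    (I : forall R : relsym L0, formula L ('I_(relar R) * 'I_n))
    (V : Type) (phi : formula L0 V) :
  quantifier_free phi ->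
  exists psi : formula L (V * 'I_n.+1),
    forall (A D E : Type) (N : structure L0 D) (M : structure L E)
      (e : A -> D) (f : A -> 'I_n -> E) (g : A -> E),
      injective e -> injective g ->
      (forall (R : relsym L0) (a : 'I_(relar R) -> A),
        rint N (e \o a) <-> sat M (fun p => f (a p.1) p.2) (I R)) ->
    forall a : V -> A,
      sat N (e \o a) phi <->
      sat M (fun p => oapp (f (a p.1)) (g (a p.1)) (unlift ord_max p.2)) psi.
Proof.
elim: phi => {V} [V|V t1 t2|V R ts|V phi1 IH1 phi2 IH2|//] /=.
- by exists fbot.
- have [[x1 ->] [x2 ->]] := (relational_tvar t1 relL0, relational_tvar t2 relL0).
  exists (feq (tvar L (x1, ord_max)) (tvar L (x2, ord_max))) => A D E N M e f g.
  move=> ie ig _ a /=; rewrite unlift_none /=.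
  by split => [/ie -> | /ig ->].
- have [x xP] := choice (fun i => relational_tvar (ts i) relL0).
  exists (rename (fun p => (x p.1, lift ord_max p.2)) (I R)).
  move=> A D E N M e f g _ _ HI a; rewrite sat_rename.
  have -> : (fun i => eval N (e \o a) (ts i)) = e \o (a \o x).
    by apply/funext => i; rewrite xP.
  apply: iff_trans (HI R (a \o x)) _.
  rewrite (_ : (_ \o _) = (fun p => f ((a \o x) p.1) p.2)) //.
  by apply/funext => p /=; rewrite liftK.
- move=> /andP[/IH1[psi1 P1] /IH2[psi2 P2]]; exists (fimp psi1 psi2).
  move=> A D E N M e f g ie ig H a /=.
  by rewrite (P1 _ _ _ _ _ _ _ _ ie ig H) (P2 _ _ _ _ _ _ _ _ ie ig H).
Qed.

Lemma qf_reduct_configuration (L0 L1 L : language) (relL0 : relational L0)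
    (relL1 : relational L1) (D E : Type) (N : structure L0 D)
    (N1 : structure L1 D) (M : structure L E) :
  qf_reduct N N1 -> infinite_set [set: E] ->
  admits_configuration (age N) M -> admits_configuration (age N1) M.
Proof.
move=> [redR _] infE /(age_configurationP relL0)[n [I IP]].
apply/(age_configurationP relL1); exists n.+1.
(* The formula for [R] must be fixed before [A], [e], [f] and [g]: it depends only on the definition
   of [R] in [N] and on [I]. *)
have J (R : relsym L1) : {psi : formula L ('I_(relar R) * 'I_n.+1) |
    forall (A : Type) (e : A -> D) (f : A -> 'I_n -> E) (g : A -> E),
      injective e -> injective g ->
      (forall (R : relsym L0) (a : 'I_(relar R) -> A),
        rint N (e \o a) <-> sat M (fun p => f (a p.1) p.2) (I R)) ->
    forall a : 'I_(relar R) -> A,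
      rint N1 (e \o a) <->
      sat M (fun p => oapp (f (a p.1)) (g (a p.1)) (unlift ord_max p.2)) psi}.
  apply: cid; have [phi [qf phiP]] := redR R.
  have [psi psiP] := qf_translation relL0 I qf.
  exists psi => A e f g ie ig H a; apply: iff_trans (phiP _) _.
  exact: psiP.
exists (fun R => sval (J R)) => A e inhA fA ie.
have [f fP] := IP A e inhA fA ie.
have [g ig] := finite_infinite_inj fA infE.
exists (fun x k => oapp (f x) (g x) (unlift ord_max k)) => R a.
by case: (J R) => psi; exact.
Qed.

(** * The structure carrying the relations of both reducts *)

Definition sum_language (L1 L2 : language) : language :=
  Language (fun f : funsym L1 + funsym L2 =>
              match f with inl f1 => funar f1 | inr f2 => funar f2 end)
           (fun R : relsym L1 + relsym L2 =>
              match R with inl R1 => relar R1 | inr R2 => relar R2 end).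

Definition sum_structure (L1 L2 : language) (D : Type) (N1 : structure L1 D)
    (N2 : structure L2 D) : structure (sum_language L1 L2) D :=
  @Structure (sum_language L1 L2) D (dom_inhabited N1)
    (fun f => match f with
              | inl f1 => fint N1 (f := f1)
              | inr f2 => fint N2 (f := f2)
              end)
    (fun R => match R with
              | inl R1 => rint N1 (R := R1)
              | inr R2 => rint N2 (R := R2)
              end).

Lemma relational_sum (L1 L2 : language) :
  relational L1 -> relational L2 -> relational (sum_language L1 L2).
Proof. by move=> r1 r2 [/r1|/r2]. Qed.

Lemma sum_configuration (L1 L2 L : language) (relL1 : relational L1)
    (relL2 : relational L2) (D E : Type) (N1 : structure L1 D)
    (N2 : structure L2 D) (M : structure L E) :
  admits_configuration (age N1) M -> admits_configuration (age N2) M ->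
  admits_configuration (age (sum_structure N1 N2)) M.
Proof.
move=> /(age_configurationP relL1)[n1 [I1 P1]].
move=> /(age_configurationP relL2)[n2 [I2 P2]].
apply/(age_configurationP (relational_sum relL1 relL2)).
(* The formulas of [I1] read the first [n1] coordinates, those of [I2] the last [n2]. *)
exists (n1 + n2)%N, (fun R : relsym (sum_language L1 L2) =>
  match R return formula L ('I_(@relar (sum_language L1 L2) R) * 'I_(n1 + n2)) with
  | inl R1 => rename (fun p => (p.1, lshift n2 p.2)) (I1 R1)
  | inr R2 => rename (fun p => (p.1, rshift n1 p.2)) (I2 R2)
  end).
move=> A e inhA fA ie.
have [f1 f1P] := P1 A e inhA fA ie.
have [f2 f2P] := P2 A e inhA fA ie.
exists (fun x k => match fintype.split k with
                   | inl k1 => f1 x k1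
                   | inr k2 => f2 x k2
                   end).
case=> R a; rewrite sat_rename.
  apply: iff_trans (f1P R a) _.
  rewrite (_ : (_ \o _) = (fun p : 'I_(relar R) * 'I_n1 => f1 (a p.1) p.2)) //.
  by apply/funext => p /=; rewrite (unsplitK (inl p.2)).
apply: iff_trans (f2P R a) _.
rewrite (_ : (_ \o _) = (fun p : 'I_(relar R) * 'I_n2 => f2 (a p.1) p.2)) //.
by apply/funext => p /=; rewrite (unsplitK (inr p.2)).
Qed.

Lemma sum_qf_reductl (L1 L2 : language) (relL1 : relational L1) (D : Type)
    (N1 : structure L1 D) (N2 : structure L2 D) :
  qf_reduct (sum_structure N1 N2) N1.
Proof.
split=> [R|f]; last by case: (relL1 f).
by exists (@Defs.frel (sum_language L1 L2) _ (inl R) (fun i => tvar _ i)).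
Qed.

Lemma sum_qf_reductr (L1 L2 : language) (relL2 : relational L2) (D : Type)
    (N1 : structure L1 D) (N2 : structure L2 D) :
  qf_reduct (sum_structure N1 N2) N2.
Proof.
split=> [R|f]; last by case: (relL2 f).
by exists (@Defs.frel (sum_language L1 L2) _ (inr R) (fun i => tvar _ i)).
Qed.

Lemma qf_reduct_sum (L L1 L2 : language) (D : Type) (N : structure L D)
    (N1 : structure L1 D) (N2 : structure L2 D) :
  qf_reduct N N1 -> qf_reduct N N2 -> qf_reduct N (sum_structure N1 N2).
Proof. by move=> [r1 f1] [r2 f2]; split=> -[]. Qed.

(** * Complete theories and the equality of the classes *)

Lemma complete_theory_equiv (L : language) (T : theory L) (E1 E2 : Type)
    (M1 : structure L E1) (M2 : structure L E2) (sigma : sentence L) :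
  complete_theory T -> models M1 T -> models M2 T ->
  holds M1 sigma -> holds M2 sigma.
Proof.
move=> [_ _ /(_ sigma)[H|H]] T1 T2 s1; first exact: H.
by have := H _ _ T1 s1.
Qed.

Theorem theorem2p17 (L0 L1 L2 : language)
    (relL0 : relational L0) (relL1 : relational L1) (relL2 : relational L2)
    (D : Type) (N : structure L0 D)
    (N1 : structure L1 D) (N2 : structure L2 D)
    (redN1 : qf_reduct N N1) (redN2 : qf_reduct N N2)
    (AutN : Aut N = Aut N1 `&` Aut N2) (joinN : qf_join N N1 N2)
    (L : language) :
  KK N1 L `&` KK N2 L = KK N L.
Proof.
have [_ _ lub] := joinN.
(* The sum is a quantifier-free reduct of [N] above both [N1] and [N2], so leastness of the join
   applies to it. *)
have redN : qf_reduct (sum_structure N1 N2) N.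
  apply: lub; first exact: qf_reduct_sum.
    exact: sum_qf_reductl.
  exact: sum_qf_reductr.
apply/seteqP; split => T /=; last first.
  (* The easy inclusion: [N1] and [N2] are reducts of [N], and the same infinite model serves for
     both. *)
  move=> [cT [E [M [MT cN]]]]; have [_ inf _] := cT.
  by split; split => //; exists E, M; split => //;
    apply: qf_reduct_configuration cN => //; exact: inf MT.
move=> [[cT [E1 [M1 [T1 c1]]]] [_ [E2 [M2 [T2 c2]]]]]; split => //.
have [_ inf _] := cT.
have [F [M [e1 [e2 [el1 el2]]]]] :=
  common_elementary_extension (fun s => complete_theory_equiv cT T1 T2).
(* The common extension satisfies [T] because [M1] does, and is therefore infinite. *)
have MT : models M T by move=> phi /T1 /(elementary_holds phi el1).
exists F, M; split => //.
apply: (qf_reduct_configuration (relational_sum relL1 relL2) relL0 redN).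
  exact: inf MT.
apply: sum_configuration => //.
  exact: elementary_configuration el1 c1.
exact: elementary_configuration el2 c2.
Qed.
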